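(* Consider the problem (E): minimize $J(x,u)=-\int_0^1x(t)\,dt$ over $(x,u)\in W^{1,1}([0,1];\mathbb R)\times L^\infty([0,1];\mathbb R)$ subject to $\dot x(t)=u(t)$ a.e., $tu(t)-t^2\le0$ a.e., $x(0)=0$, and its unique global minimizer $(\bar x(t),\bar u(t))=(t^2/2,\,t)$. A tuple $(\lambda,\beta,\lambda_0,z,\zeta)$ is a multiplier tuple for (E) at $(\bar x,\bar u)$ if and only if it is a tuple of degenerate multipliers with $\lambda\equiv\beta\equiv0$ and $\zeta$ concentrated at the origin; that is, if and only if $\lambda_0=0$, $z=0$ a.e., $\lambda\equiv\beta\equiv0$, and $\zeta$ is a nonzero positive pure charge in $\operatorname{ba}$ with $\zeta((0,\varepsilon))=\zeta([0,1])$ for all $\varepsilon>0$. In particular, the necessary conditions (existence of a multiplier tuple) do not distinguish among admissible processes of (E): each such degenerate tuple is also a multiplier tuple for (E) at every admissible process $(x,u)$ of (E), and (E) is completely degenerate, i.e. every multiplier tuple is degenerate.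
   Context: Notation. ''a.e.'' refers to Lebesgue measure $\mathrm{Leb}$; $\mathfrak L$ is the $\sigma$-algebra of Lebesgue measurable subsets of $[0,1]$. $BV([0,1];\mathbb R^n)$ denotes functions of bounded variation that are right-continuous on $(0,1)$. Charges. A charge is a finitely additive set function on $\mathfrak L$ vanishing at $\emptyset$; $\operatorname{ba}$ denotes the bounded charges vanishing on Lebesgue null sets. A positive charge $\zeta$ is pure if the only countably additive measure $\mu$ with $0\le\mu\le\zeta$ is $\mu=0$. For $k\in L^\infty$, $\int_E k\,d\zeta$ is the limit of integrals of simple functions converging to $k\chi_E$ uniformly a.e. For $\zeta\ge0$, ''$k=0$ $\zeta$-a.e.'' means $\zeta(\{|k|>\varepsilon\})=0$ for all $\varepsilon>0$. $\zeta$ is right-concentrated at $t^*$ if $\zeta((t^*,t^*+\varepsilon))=\zeta([0,1])$ for all $\varepsilon>0$, left-concentrated at $t^*$ if $\zeta((t^*-\varepsilon,t^* ))=\zeta([0,1])$ for all $\varepsilon>0$ (intervals intersected with $[0,1]$). Multiplier tuple. For a problem of minimizing $\int_0^1L(t,x,u)\,dt$ subject to $\dot x=f(t,x,u)$ a.e., $g(t,x,u)\le0$ a.e. ($g$ scalar), $x(0)=x_0$, and an admissible process (a pair satisfying the constraints), denote evaluation along the process by a bar ($\bar L_x,\bar L_u,\bar g_x,\bar g_u$ row vectors). A multiplier tuple at that process is $(\lambda,\beta,\lambda_0,z,\zeta)$ with $\lambda_0\ge0$, $z\in L^1([0,1];\mathbb R)$, $z\ge0$, $\zeta\in\operatorname{ba}$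 pure, $\zeta\ge0$, $\lambda,\beta\in BV([0,1];\mathbb R^n)$ such that: (a) $\lambda_0+\|z\|_{L^1}+\zeta([0,1])>0$; (b) $z(t)\bar g(t)=0$ a.e. and $\bar g=0$ $\zeta$-a.e.; (c) $\lambda(1)=\beta(1)=0$, $-d\lambda=[\bar f_x^T\lambda+\lambda_0\bar L_x^T+z\bar g_x^T]\,dt+d\beta$ (as measures on $[0,1]$), where $\beta(0)=-\int_0^1\bar g_x^T\,d\zeta$ and $\beta(t)=-\lim_{k\to\infty}\int_{t+1/k}^1\bar g_x^T\,d\zeta$ for $t\in(0,1)$; (d) $0=\bar f_u^T\lambda+\lambda_0\bar L_u^T+\bar g_u^Tz$ a.e., and $\int_E\bar g_u^T\,d\zeta=0$ for every $E\in\mathfrak L$. For (E): $L=-x$, $f=u$, $g=tu-t^2$, $n=1$. Degenerate. A tuple is degenerate if $\lambda_0=0$, $z\equiv0$, and there are $t^*\in[0,1]$ and $\alpha\in\mathbb R^n$ with $\lambda(t)=-\beta(t)=\alpha$ for $t<t^*$ and $=0$ for $t\ge t^*$, and $\zeta$ is a pure charge in $\operatorname{ba}$ concentrated at $t^*$ from the left or the right (when $t^*=0$, the value at the single instant $0$ is instead $\lambda(0)=-\beta(0)=\int_0^1\bar g_x^T\,d\zeta$). *)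

(* Defs.v *)
From HB Require Import structures.
From mathcomp Require Import all_boot all_order all_algebra.
From mathcomp Require Import all_classical all_reals all_analysis.

Set Implicit Arguments.
Unset Strict Implicit.
Unset Printing Implicit Defensive.

Import Order.TTheory GRing.Theory Num.Theory.
Import numFieldNormedType.Exports.
Import HBSimple.

Local Open Scope classical_set_scope.
Local Open Scope ring_scope.

(* [lebType R] is a copy of the real line whose measurable sets are the Lebesgue
   (not only the Borel) measurable ones. It is convertible to [R], where inference
   finds the Borel sets, so it is given explicitly to [measurable] and
   [measurable_fun]. Functions on [0, 1] are functions on the whole line of which
   only the values on [0, 1] matter; similarly the subsets of [0, 1] are sets of
   reals, and charges are only looked at on [LebI]. *)
Notation lebType R := (caratheodory_type (@mu_ext _ _ _ (@wlength R idfun))).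
Notation leb := (@completed_lebesgue_measure _).

Definition I01 {R : realType} : set R := `[0, 1].

Definition LebI {R : realType} : set (set (lebType R)) :=
  [set A | @measurable _ (lebType R) A /\ A `<=` I01].

Definition ae01 {R : realType} (P : R -> Prop) : Prop :=
  {ae leb, forall t : lebType R, I01 t -> P t}.

Section FunctionSpaces.
Context {R : realType}.

Definition L1 (z : R -> R) : Prop :=
  leb.-integrable I01 (fun t : lebType R => (z t)%:E).

Definition L1norm (z : R -> R) : \bar R :=
  (\int[leb]_(t in (I01 : set (lebType R))) `|z t|%:E)%E.

Definition Linfty (u : R -> R) : Prop :=
  @measurable_fun _ _ (lebType R) R I01 u /\
  exists M : R, ae01 (fun t => `|u t| <= M).

(* W^{1,1} through the absolutely continuous representatives: the indefinite
   integrals of L^1 functions. *)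
Definition W11 (x : R -> R) : Prop :=
  exists2 v : R -> R, L1 v &
    forall t, I01 t ->
      x t = x 0 + (\int[leb]_(s in (`[0, t] : set (lebType R))) v s)%R.

Definition BV01 (F : R -> R) : Prop :=
  bounded_variation 0 1 F /\
  forall t : R, 0 < t < 1 -> F r @[r --> t^'+] --> F t.

(* [dF] is the Lebesgue-Stieltjes measure on [0, 1] of [F], for F right-continuous
   on (0, 1). It has the atoms F(0+) - F(0) at 0 and F(1) - F(1-) at 1. *)
Definition stieltjes01 (F : R -> R)
    (dF : {charge set (measurableTypeR R) -> \bar R}) : Prop :=
  forall t : R, 0 < t <= 1 -> dF `[0, t]%classic = (F t - F 0)%:E.

End FunctionSpaces.

Section Charges.
Context {R : realType}.
Implicit Type zeta : {additive_charge set (lebType R) -> \bar R}.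
Local Open Scope ereal_scope.

Definition ba zeta : Prop :=
  (exists M : R, forall A, LebI A -> `|zeta A| <= M%:E) /\
  (forall A, LebI A -> leb A = 0 -> zeta A = 0).

Definition nonneg_charge zeta : Prop := forall A, LebI A -> 0 <= zeta A.

Definition pure_charge zeta : Prop :=
  nonneg_charge zeta /\
  forall mu : {measure set (lebType R) -> \bar R},
    (forall A, LebI A -> mu A <= zeta A) -> forall A, LebI A -> mu A = 0.

(* The integral over E of k against zeta exists and is equal to l. The bound is
   that of convergence in L^oo of the simple functions s_n to k \chi_E. *)
Definition is_charge_integral zeta (E : set R) (k : R -> R) (l : R) : Prop :=
  exists s : nat -> {sfun lebType R >-> R},
    (forall e : R, (0 < e)%R -> \forall n \near \oo,
      ae01 (fun t => `|s n t - (k \_ E) t| <= e)%R) /\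
    sintegral (fun A => zeta (A `&` I01)) (s n) @[n --> \oo] --> l%:E.

Definition charge_ae_zero zeta (k : R -> R) : Prop :=
  forall e : R, (0 < e)%R -> zeta (I01 `&` [set t | (e < `|k t|)%R]) = 0.

Definition right_concentrated zeta (t : R) : Prop :=
  forall e : R, (0 < e)%R -> zeta (`]t, (t + e)%R[ `&` I01) = zeta I01.

Definition left_concentrated zeta (t : R) : Prop :=
  forall e : R, (0 < e)%R -> zeta (`](t - e)%R, t[ `&` I01) = zeta I01.

End Charges.

(* Minimize the integral of [ocL] over [0, 1] subject to x' = ocf a.e.,
   ocg <= 0 a.e. and x(0) = ocx0; the arguments of the data are t, x, u. *)
Record control_problem (R : realType) := ControlProblem {
  ocL : R -> R -> R -> R ;
  ocf : R -> R -> R -> R ;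
  ocg : R -> R -> R -> R ;
  ocx0 : R }.

Section Multipliers.
Context {R : realType} (P : control_problem R).

Definition admissible (x u : R -> R) : Prop :=
  [/\ W11 x, Linfty u,
      ae01 (fun t => is_derive t 1 x (ocf P t (x t) (u t))),
      ae01 (fun t => ocg P t (x t) (u t) <= 0) &
      x 0 = ocx0 P].

Definition cost (x u : R -> R) : \bar R :=
  (\int[leb]_(t in (I01 : set (lebType R))) (ocL P t (x t) (u t))%:E)%E.

Definition global_minimizer (x u : R -> R) : Prop :=
  admissible x u /\
  forall y v, admissible y v -> (cost x u <= cost y v)%E.

Section Process.
Variables x u : R -> R.

Definition along (h : R -> R -> R -> R) (t : R) : R := h t (x t) (u t).
Definition along_x (h : R -> R -> R -> R) (t : R) : R :=
  derive1 (fun y => h t y (u t)) (x t).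
Definition along_u (h : R -> R -> R -> R) (t : R) : R :=
  derive1 (fun v => h t (x t) v) (u t).

Definition adjoint_density (lambda : R -> R) (lambda0 : R) (z : R -> R) (t : R)
    : R :=
  along_x (ocf P) t * lambda t + lambda0 * along_x (ocL P) t
    + z t * along_x (ocg P) t.

(* - d lambda = adjoint_density dt + d beta, as measures on [0, 1] *)
Definition adjoint_equation (lambda beta : R -> R) (lambda0 : R) (z : R -> R)
    : Prop :=
  L1 (adjoint_density lambda lambda0 z) /\
  exists dlambda dbeta : {charge set (measurableTypeR R) -> \bar R},
    [/\ stieltjes01 lambda dlambda, stieltjes01 beta dbeta &
        forall A : set (measurableTypeR R), measurable A -> A `<=` I01 ->
          (- dlambda A =
           \int[leb]_(t in (A : set (lebType R)))
             (adjoint_density lambda lambda0 z t)%:E + dbeta A)%E].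

Definition beta_from_charge (beta : R -> R)
    (zeta : {additive_charge set (lebType R) -> \bar R}) : Prop :=
  is_charge_integral zeta I01 (along_x (ocg P)) (- beta 0) /\
  forall t : R, 0 < t < 1 -> exists c : nat -> R,
    (forall k, is_charge_integral zeta `[t + k.+1%:R^-1, 1]
                 (along_x (ocg P)) (c k)) /\
    c k @[k --> \oo] --> - beta t.

Record multiplier_tuple (lambda beta : R -> R) (lambda0 : R) (z : R -> R)
    (zeta : {additive_charge set (lebType R) -> \bar R}) : Prop := {
  mt_lambda0_ge0 : 0 <= lambda0 ;
  mt_z_L1 : L1 z ;
  mt_z_ge0 : ae01 (fun t => 0 <= z t) ;
  mt_zeta_ba : ba zeta ;
  mt_zeta_pure : pure_charge zeta ;
  mt_lambda_BV : BV01 lambda ;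
  mt_beta_BV : BV01 beta ;
  mt_nontrivial : (0 < lambda0%:E + L1norm z + zeta I01)%E ;
  mt_z_compl : ae01 (fun t => z t * along (ocg P) t = 0) ;
  mt_zeta_compl : charge_ae_zero zeta (along (ocg P)) ;
  mt_lambda1 : lambda 1 = 0 ;
  mt_beta1 : beta 1 = 0 ;
  mt_adjoint : adjoint_equation lambda beta lambda0 z ;
  mt_beta : beta_from_charge beta zeta ;
  mt_stationary : ae01 (fun t =>
    0 = along_u (ocf P) t * lambda t + lambda0 * along_u (ocL P) t
          + along_u (ocg P) t * z t) ;
  mt_zeta_stationary : forall E : set (lebType R), LebI E ->
    is_charge_integral zeta E (along_u (ocg P)) 0 }.

Definition degenerate (lambda beta : R -> R) (lambda0 : R) (z : R -> R)
    (zeta : {additive_charge set (lebType R) -> \bar R}) : Prop :=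
  lambda0 = 0 /\ ae01 (fun t => z t = 0) /\
  exists ts alpha : R,
    [/\ I01 ts,
        forall t, I01 t -> t < ts -> lambda t = alpha /\ - beta t = alpha,
        (* the condition [0 < t] only matters for ts = 0 *)
        forall t, I01 t -> ts <= t -> 0 < t -> lambda t = 0 /\ - beta t = 0,
        ts = 0 -> lambda 0 = - beta 0 /\
          is_charge_integral zeta I01 (along_x (ocg P)) (lambda 0) &
        [/\ ba zeta, pure_charge zeta &
            left_concentrated zeta ts \/ right_concentrated zeta ts]].

End Process.

Definition completely_degenerate : Prop :=
  forall x u, admissible x u ->
  forall lambda beta lambda0 z zeta,
    multiplier_tuple x u lambda beta lambda0 z zeta ->
    degenerate x u lambda beta lambda0 z zeta.

End Multipliers.

Definition problemE (R : realType) : control_problem R := {|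
  ocL := fun t x u => - x ;
  ocf := fun t x u => u ;
  ocg := fun t x u => t * u - t ^+ 2 ;
  ocx0 := 0 |}.

Definition xbar {R : realType} (t : R) : R := t ^+ 2 / 2.
Definition ubar {R : realType} (t : R) : R := t.

Definition zero01 {R : realType} (F : R -> R) : Prop := forall t, I01 t -> F t = 0.

Definition origin_tuple {R : realType} (lambda beta : R -> R) (lambda0 : R)
    (z : R -> R) (zeta : {additive_charge set (lebType R) -> \bar R}) : Prop :=
  [/\ lambda0 = 0, ae01 (fun t => z t = 0), zero01 lambda, zero01 beta &
      [/\ exists2 A, LebI A & zeta A <> 0%E, pure_charge zeta, ba zeta &
          forall e : R, 0 < e -> zeta (`]0, e[ `&` I01) = zeta I01]].

(* Main.v *)
(* Since g_x = 0 and g_u = t, the singular part of a multiplier tuple forces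
   beta = 0 and zeta [a, 1] = 0 for all a > 0: zeta lives at 0+.  The adjoint
   equation then gives lambda t = - lambda0 (1 - t), and stationarity gives
   z t = lambda0 (1 - t) / t, which is integrable only if lambda0 = 0.
   Conversely, a charge living at 0+ integrates every function vanishing at 0+
   to 0, and all the conditions hold along any admissible process.

   For the minimizer, an admissible x is absolutely continuous with derivative
   u t <= t a.e., so x - xbar is nonincreasing; hence x <= xbar, and the cost
   detects any strict inequality. *)

Require Import Defs.
From HB Require Import structures.
From mathcomp Require Import all_boot all_order all_algebra.
From mathcomp Require Import all_classical all_reals all_analysis.
From mathcomp Require Import measurable_realfun ring lra.

Set Implicit Arguments.
Unset Strict Implicit.
Unset Printing Implicit Defensive.

Import Order.TTheory GRing.Theory Num.Theory.
Import numFieldNormedType.Exports.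

Local Open Scope classical_set_scope.
Local Open Scope ring_scope.

(** * Null sets of [0, 1] and values of charges *)

(** A charge is only finitely additive, so no convergence theorem is at hand, and
    [is_charge_integral] is a relation whose approximants are controlled only up to null sets. No
    calculus is built on it. Values are pinned down by one inequality, [charge_integral_ge], which
    compares any value of the integral with a two-level step function; existence is shown with
    approximants whose simple integrals all vanish exactly. For the minimizer, [W11] presents x as
    the integral of some density v, whereas dynamics and constraint concern the pointwise derivative
    u. The proof never identifies v with u: v serves only for absolute continuity, u only for the
    sign of the derivative. *)

Section LebesgueMeasurability.
Context {R : realType}.

Lemma borel_lebesgue_measurable (A : set R) :
  measurable A -> @measurable _ (lebType R) A.
Proof. by move=> mA; apply: sub_caratheodory; exact: mA. Qed.

Lemma measurable_I01 : @measurable _ (lebType R) I01.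
Proof. by apply: borel_lebesgue_measurable; exact: measurable_itv. Qed.

Lemma measurable_fun_lebesgue (D : set R) (f : R -> R) :
  measurable D -> measurable_fun D f -> @measurable_fun _ _ (lebType R) R D f.
Proof.
by move=> mD mf _ Y mY; apply: borel_lebesgue_measurable; exact: mf.
Qed.

Lemma leb_itv (i : interval R) :
  leb ([set` i] : set (lebType R)) =
  (if i.1 < i.2 then (i.2 : \bar R) - i.1 else 0)%E.
Proof. exact: lebesgue_measure_itv. Qed.

(** Since [leb] is complete, the exceptional set itself is measurable, and not just contained in a
    null set; hence a charge in [ba] can be evaluated on it. *)
Lemma ae01_null (P : R -> Prop) : ae01 P <->
  @measurable _ (lebType R) [set t | I01 t /\ ~ P t] /\
  leb ([set t | I01 t /\ ~ P t] : set (lebType R)) = 0%E.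
Proof.
have -> : ae01 P =
    leb.-negligible ([set t | I01 t /\ ~ P t] : set (lebType R)).
  rewrite (_ : [set t | I01 t /\ ~ P t] = ~` [set t | I01 t -> P t])//.
  by apply/seteqP; split=> t /= /not_implyP.
split=> [nB|[mB B0]]; last by exists [set t | I01 t /\ ~ P t]; split.
have mB : @measurable _ (lebType R) [set t | I01 t /\ ~ P t].
  exact: completed_lebesgue_measure_is_complete.
by split => //; exact/(negligibleP _ mB).
Qed.

Lemma ae01_imply (P Q : R -> Prop) :
  (forall t, I01 t -> P t -> Q t) -> ae01 P -> ae01 Q.
Proof.
by move=> PQ; rewrite /ae01; apply: filterS => t Pt t01; exact/PQ/Pt.
Qed.

Lemma ae01_imply2 (P Q S : R -> Prop) :
  (forall t, I01 t -> P t -> Q t -> S t) -> ae01 P -> ae01 Q -> ae01 S.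
Proof.
move=> PQS; rewrite /ae01; apply: filterS2 => t Pt Qt t01.
exact: PQS (Pt t01) (Qt t01).
Qed.

Lemma ae01W (P : R -> Prop) : (forall t, I01 t -> P t) -> ae01 P.
Proof. by move=> h; apply: aeW. Qed.

Lemma ae01_neq (a : R) : ae01 (fun t => t != a).
Proof.
exists [set a]; split.
- by apply: borel_lebesgue_measurable; exact: measurable_set1.
- by rewrite -(set_itv1 a) leb_itv/= ltxx.
- by move=> t /= /not_implyP[_ /negP/negPn/eqP].
Qed.

Lemma I01P (t : R) : I01 t <-> 0 <= t <= 1.
Proof. by rewrite /I01/= in_itv/=. Qed.

Lemma ae01_interior (P : R -> Prop) :
  (forall t, 0 < t < 1 -> P t) -> ae01 P.
Proof.
move=> h; apply: (ae01_imply2 _ (ae01_neq 0) (ae01_neq 1)).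
move=> t /I01P/andP[t0 t1] tn0 tn1; apply: h.
by rewrite !lt_neqAle eq_sym tn0 tn1 t0.
Qed.

End LebesgueMeasurability.

Section AdditiveCharge.
Import HBSimple.
Context {R : realType}.
Variable zeta : {additive_charge set (lebType R) -> \bar R}.
Implicit Types A B : set (lebType R).

Definition cval A : R := fine (zeta A).

Lemma cvalE A : measurable A -> zeta A = (cval A)%:E.
Proof. by move=> mA; rewrite fineK// fin_num_measure. Qed.

Lemma additive_charge0 : zeta set0 = 0%E.
Proof.
have /[!big_ord0] ->// := @charge_semi_additive _ _ _ zeta (fun=> set0) 0%N.
exact: trivIset_set0.
Qed.

Lemma cval0 : cval set0 = 0.
Proof. by rewrite /cval additive_charge0. Qed.

Lemma cvalU A B : measurable A -> measurable B -> A `&` B = set0 ->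
  cval (A `|` B) = cval A + cval B.
Proof.
move=> mA mB AB0; apply: EFin_inj; rewrite EFinD -!cvalE//; last first.
  exact: measurableU.
have /semi_additiveW := @charge_semi_additive _ _ _ zeta.
by apply => //; [exact: additive_charge0|exact: measurableU].
Qed.

Lemma cvalID A B : measurable A -> measurable B ->
  cval A = cval (A `&` B) + cval (A `\` B).
Proof.
move=> mA mB; rewrite -cvalU ?setUIDK//.
- exact: measurableI.
- exact: measurableD.
- by rewrite setDE setIACA setICr setI0.
Qed.

Lemma cval_partition (s : {sfun lebType R >-> R}) (r : seq R) A :
  measurable A -> uniq r -> (forall t, s t \in r) ->
  cval A = \sum_(x <- r) cval (s @^-1` [set x] `&` A).
Proof.
move=> mA ur sr.
have ms (B : set R) : measurable B -> measurable (s @^-1` B : set (lebType R)).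
  by move=> mB; rewrite -[X in measurable X]setTI; exact: measurable_funPT.
have mseq (q : seq R) : @measurable _ R [set` q].
  apply: countable_measurable; first exact: measurable_set1.
  exact/finite_set_countable/finite_seq.
have -> : cval A = cval (s @^-1` [set` r] `&` A).
  congr cval; apply/seteqP; split => [t At|t []//]; split => //=.
elim: r ur {sr} => [_|x r ih /= /andP[xr ur]].
  rewrite big_nil (_ : _ `&` _ = set0) ?cval0//.
  by apply/seteqP; split => // t [].
rewrite big_cons -ih// -cvalU//.
- congr cval; rewrite -setIUl; congr (_ `&` _).
  apply/seteqP; split => t /=; rewrite inE.
    by move=> /orP[/eqP|]; [left|right].
  by move=> [->|->]; rewrite ?eqxx ?orbT.
- by apply: measurableI => //; exact: ms.
- by apply: measurableI => //; exact: ms.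
- rewrite setIACA; apply/seteqP; split => // t [/= [-> xr'] _].
  by rewrite xr' in xr.
Qed.

Lemma sintegral_seq (s : {sfun lebType R >-> R}) :
  exists r : seq R, [/\ uniq r, forall t, s t \in r &
    sintegral (fun A => zeta (A `&` I01)) s =
      (\sum_(x <- r) x * cval (s @^-1` [set x] `&` I01))%:E].
Proof.
have /finite_seqP[r0 rE] := @fimfunP _ _ s.
exists (undup r0); split.
- exact: undup_uniq.
- move=> t; rewrite mem_undup.
  by have : range s (s t) by []; rewrite rE.
- rewrite /sintegral -(@fsbig_widen _ _ _ _ (range s))//=; last first.
    move=> x [_ Nx] /=; rewrite (_ : _ `&` _ = set0).
      by rewrite additive_charge0 mule0.
    by apply/seteqP; split => // t [/= tx _]; apply: Nx; exists t.
  rewrite rE (_ : [set` r0] = [set` undup r0]); last first.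
    by apply/seteqP; split => t /=; rewrite mem_undup.
  rewrite -fsbig_seq ?undup_uniq// -sumEFin; apply: eq_bigr => x _.
  rewrite cvalE//; apply: measurableI; last exact: measurable_I01.
  by rewrite -[X in measurable X]setTI; exact: measurable_funPT.
Qed.

End AdditiveCharge.

(** * Integrals against nonnegative charges *)

Section ChargeIntegral.
Context {R : realType}.
Variable zeta : {additive_charge set (lebType R) -> \bar R}.
Hypotheses (zeta_ba : ba zeta) (zeta_ge0 : nonneg_charge zeta).
Implicit Types A B : set (lebType R).
Import HBSimple.

Lemma cval_ge0 A : LebI A -> 0 <= cval zeta A.
Proof. by move=> hA; rewrite -lee_fin -cvalE//; [exact: zeta_ge0|case: hA]. Qed.

Lemma cval_null A : LebI A -> leb A = 0%E -> cval zeta A = 0.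
Proof. by move=> hA A0; rewrite /cval (zeta_ba.2 _ hA A0). Qed.

Lemma le_cval A B : LebI A -> LebI B -> A `<=` B -> cval zeta A <= cval zeta B.
Proof.
move=> [mA A01] [mB B01] AB; rewrite (cvalID zeta mB mA) setIC setIidl//.
rewrite lerDl cval_ge0//; split; first exact: measurableD.
exact: subset_trans B01.
Qed.

Lemma LebI_I01 : LebI (I01 : set (lebType R)).
Proof. by split => //; exact: measurable_I01. Qed.

Lemma LebIID A B : LebI A -> measurable B -> LebI (A `&` B) /\ LebI (A `\` B).
Proof.
move=> [mA A01] mB; split; split.
- exact: measurableI.
- by apply: subset_trans A01; exact: subIsetl.
- exact: measurableD.
- exact: subset_trans A01.
Qed.

(** If y < c, then P fails at every point of A, so A is null and both sides vanish. With A inside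
    the level set of a simple function at y, this turns closeness a.e. into an inequality between
    terms of finite sums. *)
Lemma cval_mulr_ge (P : R -> Prop) A (c y : R) : LebI A -> ae01 P ->
  (forall t, A t -> P t -> c <= y) -> c * cval zeta A <= y * cval zeta A.
Proof.
move=> hA /ae01_null[mB B0] Py.
have [cy|yc] := leP c y; first by rewrite ler_wpM2r// cval_ge0.
rewrite cval_null ?mulr0//; apply/eqP; rewrite -measure_le0 -B0.
apply: le_measure => //; rewrite ?inE//; first by case: hA.
move=> t At; split; first by case: hA => _; exact.
by move=> Pt; move: (Py t At Pt); rewrite leNgt yc.
Qed.

(* [sg] is 1 for a lower and -1 for an upper bound. *)
Lemma charge_integral_ge (E : set R) (k : R -> R) (l sg c d : R) D :
  LebI D -> is_charge_integral zeta E k l -> `|sg| = 1 ->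
  (forall t, D t -> c <= sg * (k \_ E) t) ->
  (forall t, I01 t -> ~ D t -> d <= sg * (k \_ E) t) ->
  c * cval zeta D + d * cval zeta (I01 `\` D) <= sg * l.
Proof.
move=> hD [s [sk sl]] sg1 cD dD.
apply/ler_addgt0Pl => e e0.
have z0 : 0 <= cval zeta I01 by exact/cval_ge0/LebI_I01.
(* Replacing the integrand by a simple function costs e1 times zeta of [I01], replacing the limit l
   by a term of the sequence costs e1: e altogether. *)
pose e1 := e / (1 + cval zeta I01).
have e10 : 0 < e1 by rewrite divr_gt0// ltr_pwDl.
have [n [skn sln]] : exists n, ae01 (fun t => `|s n t - (k \_ E) t| <= e1) /\
    `|l - fine (sintegral (fun A => zeta (A `&` I01)) (s n))| < e1.
  have /fine_cvgP[_ /cvgrPdist_lt /(_ _ e10) fl] := sl.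
  have [n _ /(_ n (leqnn n)) [h1 h2]] := filterI (sk _ e10) fl.
  by exists n.
have [r [ur sr sE]] := sintegral_seq zeta (s n).
set S := \sum_(x <- r) _ in sE.
have ms x : measurable (s n @^-1` [set x] : set (lebType R)).
  by rewrite -[X in measurable X]setTI; exact: measurable_funPT.
(* Each level set is cut along D, because the lower bound of the integrand switches from c to d
   there. *)
have SE : S = \sum_(x <- r) (x * cval zeta (s n @^-1` [set x] `&` D) +
                             x * cval zeta (s n @^-1` [set x] `&` (I01 `\` D))).
  apply: eq_bigr => x _; rewrite -mulrDr; congr *%R.
  rewrite (@cvalID _ _ _ D).
  - rewrite setIDA -setIA (@setIidr _ I01)//. by case: hD.
  - by apply: measurableI => //; exact: measurable_I01.
  - by case: hD.
have hDC : LebI (I01 `\` D).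
  by have [] := LebIID LebI_I01 (proj1 hD).
have SD x B : LebI B -> LebI (s n @^-1` [set x] `&` B).
  by move=> hB; rewrite setIC; have [] := LebIID hB (ms x).
have Sge : (c - e1) * cval zeta D + (d - e1) * cval zeta (I01 `\` D) <= sg * S.
  rewrite SE mulr_sumr (cval_partition _ (proj1 hD) ur sr).
  rewrite (cval_partition _ (proj1 hDC) ur sr) !mulr_sumr -big_split/=.
  apply: ler_sum => x _; rewrite mulrDr !mulrA; apply: lerD.
  - apply: cval_mulr_ge skn _; first exact: SD.
    move=> t [/= <- Dt]; move=> st.
    rewrite (le_trans (lerB (cD t Dt) (lexx e1)))// lerBlDr.
    rewrite -lerBlDl -mulrBr (le_trans (ler_norm _))// normrM sg1 mul1r.
    by rewrite distrC.
  - apply: cval_mulr_ge skn _; first exact: SD.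
    move=> t [/= <- [It Dt]]; move=> st.
    rewrite (le_trans (lerB (dD t It Dt) (lexx e1)))// lerBlDr.
    rewrite -lerBlDl -mulrBr (le_trans (ler_norm _))// normrM sg1 mul1r.
    by rewrite distrC.
have Sl : sg * S <= sg * l + e1.
  move: sln; rewrite sE/= => Sl.
  rewrite -lerBlDl -mulrBr (le_trans (ler_norm _))// normrM sg1 mul1r.
  by rewrite distrC ltW.
have zI : cval zeta D + cval zeta (I01 `\` D) = cval zeta I01.
  rewrite (@cvalID _ _ I01 D) ?setIidr//; first by case: hD.
  - exact: measurable_I01.
  - by case: hD.
have : e = e1 * (1 + cval zeta I01) by rewrite divfK// gt_eqF// ltr_pwDl.
rewrite -zI; lra.
Qed.

Lemma charge_integral0 (E : set R) (l : R) :
  is_charge_integral zeta E (fun=> 0) l -> l = 0.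
Proof.
move=> h; apply/eqP; rewrite eq_le.
have k0 (sg t : R) : (0 : R) <= sg * ((fun=> 0) \_ E) t.
  by rewrite patchE; case: ifP => _; rewrite mulr0.
have /= := charge_integral_ge LebI_I01 h (normr1 _)
  (fun t _ => k0 1 t) (fun t _ _ => k0 1 t).
rewrite !mul0r addr0 mul1r => ->; rewrite andbT.
have /= := charge_integral_ge LebI_I01 h (normrN1 _)
  (fun t _ => k0 (-1) t) (fun t _ _ => k0 (-1) t).
by rewrite !mul0r addr0 mulN1r oppr_ge0.
Qed.

Lemma LebI_itvc1 (a : R) : 0 <= a -> LebI (`[a, 1]%classic : set (lebType R)).
Proof.
move=> a0; split.
  by apply: borel_lebesgue_measurable; exact: measurable_itv.
by move=> t; rewrite /I01/= !in_itv/= => /andP[at_ ->]; rewrite (le_trans a0).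
Qed.

(** The integrand is at least a on [a, 1], so a times zeta [a, 1] is at most the integral, which is
    0. *)
Lemma charge_integral_id0 (a : R) : 0 < a ->
  is_charge_integral zeta `[a, 1] id 0 -> cval zeta `[a, 1]%classic = 0.
Proof.
move=> a0 h; have hD := LebI_itvc1 (ltW a0).
apply/eqP; rewrite eq_le (cval_ge0 hD) andbT -(pmulr_rle0 _ a0).
have := @charge_integral_ge _ _ _ 1 a 0 _ hD h (normr1 _).
rewrite mul1r mul0r addr0; apply => t.
  move=> ta; rewrite mul1r patchE mem_set//.
  by move: ta; rewrite /= in_itv => /andP[].
by move=> _ ta; rewrite mul1r patchE memNset.
Qed.

End ChargeIntegral.

(** * Charges living at 0+ *)

Section OriginCharge.
Context {R : realType}.
Variable zeta : {additive_charge set (lebType R) -> \bar R}.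
Hypotheses (zeta_ba : ba zeta) (zeta_ge0 : nonneg_charge zeta).
Import HBSimple.

Lemma cval_tail0 : right_concentrated zeta 0 ->
  forall a : R, 0 < a -> cval zeta `[a, 1]%classic = 0.
Proof.
move=> zc a a0; have h1 := LebI_itvc1 (ltW a0).
apply/eqP; rewrite eq_le cval_ge0// andbT.
have [[m1 I1] [m2 I2]] := LebIID LebI_I01 (proj1 h1).
have zI : cval zeta (`]0, a[ `&` I01) = cval zeta I01.
  by rewrite /cval; have := zc a a0; rewrite add0r => ->.
have := cvalID zeta measurable_I01 (proj1 h1).
rewrite setIidr; last by case: h1.
suff : cval zeta (`]0, a[ `&` I01) <= cval zeta (I01 `\` `[a, 1]) by lra.
apply: le_cval => //.
  split; last exact: subIsetr.
  apply: measurableI; last exact: measurable_I01.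
  by apply: borel_lebesgue_measurable; exact: measurable_itv.
move=> t [/= t0a t01]; split => //=.
move: t0a; rewrite !in_itv/= => /andP[_ ta].
by apply/negP; rewrite negb_and -ltNge ta.
Qed.

(** What []0, e[] leaves of [I01] is the origin and a tail. The origin is a Lebesgue null set, so a
    charge in [ba] gives it no mass. *)
Lemma right_concentrated_tail0 :
  (forall a : R, 0 < a -> cval zeta `[a, 1]%classic = 0) ->
  right_concentrated zeta 0.
Proof.
move=> za e e0; rewrite add0r.
have mo : @measurable _ (lebType R) `]0, e[%classic.
  by apply: borel_lebesgue_measurable; exact: measurable_itv.
have m0 : @measurable _ (lebType R) [set 0].
  by apply: borel_lebesgue_measurable; exact: measurable_set1.
have L0 : LebI ([set 0] : set (lebType R)).
  by split => // _ ->; rewrite /I01/= in_itv/= lexx ler01.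
have h1 := LebI_itvc1 (ltW e0).
have hU : LebI ([set 0] `|` `[e, 1] : set (lebType R)).
  split; first by apply: measurableU => //; case: h1.
  by rewrite subUset; split; [case: L0|case: h1].
have [hI hD] := LebIID LebI_I01 mo.
rewrite setIC !cvalE; [|exact: measurable_I01|by case: hI].
rewrite [in RHS](cvalID zeta measurable_I01 mo).
suff -> : cval zeta (I01 `\` `]0, e[) = 0 by rewrite addr0.
apply/eqP; rewrite eq_le cval_ge0// andbT.
apply: (@le_trans _ _ (cval zeta ([set 0] `|` `[e, 1]))).
  apply: le_cval => // t [/=]; rewrite /I01/= !in_itv/= => /andP[t0 t1] tN.
  have [te|et] := ltP t e; last by right.
  left; apply/eqP; rewrite eq_le t0 andbT leNgt; apply/negP => t0'.
  by apply: tN; rewrite t0' te.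
rewrite cvalU//.
- rewrite za// addr0 cval_null//.
  have := @leb_itv R `[0, 0]; rewrite ltxx => <-; congr leb.
  by rewrite set_itv1.
- by case: h1.
- by apply/seteqP; split=> // t [/= ->] /=; rewrite in_itv/= leNgt e0.
Qed.

Hypothesis zeta_tail : forall a : R, 0 < a -> cval zeta `[a, 1]%classic = 0.

Lemma cval_away0 (A : set (lebType R)) (a : R) : LebI A -> 0 < a ->
  A `<=` `[a, 1] -> cval zeta A = 0.
Proof.
move=> hA a0 Aa; apply/eqP; rewrite eq_le cval_ge0// andbT -(zeta_tail a0).
by apply: le_cval => //; exact: LebI_itvc1 (ltW a0).
Qed.

(** Rounding t down to a multiple of 1/(n+1) stays within 1/(n+1) of t and is 0 on [[0, 1/(n+1)[].
    Every nonzero value is thus taken inside [1/(n+1), 1], where zeta vanishes, and the simple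
    integrals are exactly 0. Rounding up would give a nonzero value next to the origin, where zeta
    has its mass. *)
Definition floor_step (n : nat) (t : R) : R :=
  (Num.truncn (n.+1%:R * t))%:R / n.+1%:R.

Definition floor_approx (E : set R) (n : nat) : lebType R -> R :=
  floor_step n \_ E.

Lemma floor_approx_sfun (E : set (lebType R)) n : LebI E ->
  floor_approx E n \in @sfun _ (lebType R) R.
Proof.
move=> [mE E01]; apply/andP; rewrite !inE; split => /=.
  apply/(measurable_restrictT _ mE).
  apply: (@measurable_funS _ _ _ _ setT) => //.
  apply: measurable_fun_lebesgue => //.
  apply: nondecreasing_measurable => // s t st.
  (* Measurability comes from monotonicity, the finite range from E being a subset of [0, 1]: the
     numerators are at most n+1. *)
  by rewrite /floor_step ler_pM2r// ler_nat le_truncn// ler_pM2l.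
apply: (@sub_finite_set _ _ [set (k%:R / n.+1%:R : R) | k in `I_n.+2]).
  move=> _ [t _ <-]; rewrite /floor_approx patchE /floor_step.
  case: ifPn => tE /=; last first.
    by exists 0%N => //; rewrite mul0r.
  exists (Num.truncn (n.+1%:R * t)) => //=.
  rewrite ltnS truncn_le_nat.
  have : I01 t by apply: E01; rewrite inE in tE.
  rewrite /I01/= in_itv/= => /andP[_ t1].
  rewrite (@le_lt_trans _ _ n.+1%:R) ?ltr_nat//.
  by rewrite ler_piMr.
exact/finite_image/finite_II.
Qed.

Lemma charge_integral_id_origin (E : set (lebType R)) : LebI E ->
  is_charge_integral zeta E id 0.
Proof.
move=> hE; exists (fun n => sfun_Sub (floor_approx_sfun n hE)); split.
  move=> e e0; near=> n; apply: ae01W => t t01.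
  rewrite sfun_valP /floor_approx !patchE /floor_step.
  case: ifPn => tE; last by rewrite subrr normr0 ltW.
  have t0 : 0 <= t by move: t01; rewrite /I01/= in_itv/= => /andP[].
  have n0 : (0 : R) < n.+1%:R by [].
  have /andP[h1 h2] : (Num.truncn (n.+1%:R * t))%:R <= n.+1%:R * t <
     (Num.truncn (n.+1%:R * t)).+1%:R by apply: truncn_itv; rewrite mulr_ge0.
  rewrite distrC ger0_norm; last by rewrite subr_ge0 ler_pdivrMr// [t * _]mulrC.
  apply: (@le_trans _ _ n.+1%:R^-1).
    rewrite lerBlDr -[X in X + _]mul1r -mulrDl ler_pdivlMr//.
    by rewrite [t * _]mulrC addrC natr1 ltW.
  by apply/ltW; near: n; exact: (near_infty_natSinv_lt (PosNum e0)).
apply: cvg_near_cst; apply: nearW => n.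
rewrite /sintegral fsbig1// => x _.
have [->|x0] := eqVneq x 0; first by rewrite mul0e.
have mx : LebI ((sfun_Sub (floor_approx_sfun n hE)) @^-1` [set x] `&` I01).
  split; last exact: subIsetr.
  apply: measurableI; last exact: measurable_I01.
  by rewrite -[X in measurable X]setTI; exact: measurable_funPT.
rewrite cvalE; last by case: mx.
rewrite (@cval_away0 _ n.+1%:R^-1) ?mule0//.
move=> t [/=]; rewrite ?sfun_valP /floor_approx patchE /floor_step.
case: ifPn => _ tx; last by rewrite -tx eqxx in x0.
rewrite /I01/= !in_itv/= => /andP[t0 ->]; rewrite andbT.
rewrite -[leLHS]mul1r ler_pdivrMr// [t * _]mulrC.
rewrite (@le_trans _ _ (Num.truncn (n.+1%:R * t))%:R)//; last first.
  by rewrite truncn_le mulr_ge0.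
rewrite (ler_nat _ 1) lt0n; apply: contra_neqN x0 => /eqP k0.
by rewrite -tx k0 mul0r.
Unshelve. all: by end_near. Qed.

Lemma charge_ae_zero_origin (u : R -> R) : Linfty u ->
  charge_ae_zero zeta (fun t => t * u t - t ^+ 2).
Proof.
move=> [mu [M uM]] e e0.
pose k t := t * u t - t ^+ 2.
have mk : @measurable_fun _ _ (lebType R) R I01 (fun t => `|k t|).
  have mid : @measurable_fun _ _ (lebType R) R I01 id.
    by apply: measurable_fun_lebesgue => //; exact: measurable_itv.
  apply: measurableT_comp => //; apply: measurable_funB.
    exact: measurable_funM.
  exact: measurable_funX.
have mA : @measurable _ (lebType R) (I01 `&` [set t | e < `|k t|]).
  have := mk measurable_I01 _ (measurable_itv `]e, +oo[).
  congr measurable; apply/seteqP.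
  by split => t [/= ? /[!in_itv]/=]; rewrite andbT.
have hA : LebI (I01 `&` [set t | e < `|k t|] : set (lebType R)).
  by split => //; exact: subIsetl.
move: (uM) => /ae01_null[mB B0].
rewrite cvalE//; congr EFin.
(* Where [|u t| <= M], the constraint satisfies |t u - t^2| <= t (|M| + 1), so a value above e
   forces t >= a. The remaining points form a null set. *)
pose a := e / (`|M| + 1); have a0 : 0 < a by rewrite divr_gt0// ltr_wpDl.
rewrite (cvalID _ mA mB) (@cval_null _ zeta); [|by []| |]; last 2 first.
- by have [] := LebIID hA mB.
- apply/eqP; rewrite -measure_le0 -B0; apply: le_measure => //.
  - by rewrite inE; exact: measurableI.
  - by rewrite inE.
rewrite add0r (@cval_away0 _ a)//; first by have [] := LebIID hA mB.
move=> t [[/= t01 ek] tB].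
have uMt : `|u t| <= M by apply: contrapT => h; apply: tB.
move: t01; rewrite /I01/= !in_itv/= => /andP[t0 t1]; rewrite t1 andbT.
rewrite /a ler_pdivrMr ?ltr_wpDl//; apply: le_trans (ltW ek) _.
rewrite /k expr2 -mulrBr normrM (ger0_norm t0) ler_wpM2l//.
apply: le_trans (ler_normB _ _) _.
by rewrite lerD// ?(le_trans uMt) ?ler_norm// ger0_norm.
Qed.

End OriginCharge.

(** * Multiplier tuples *)

Section AbsoluteContinuity.
Context {R : realType}.

(** Extending v by 0 outside [I01] reduces this to absolute continuity of the integral on the whole
    line. *)
Lemma L1_absolutely_continuous (v : R -> R) (e : R) : L1 v -> 0 < e ->
  exists2 d : R, 0 < d & forall A : set (lebType R), LebI A ->
    (leb A < d%:E -> \int[leb]_(t in A) `|v t|%:E < e%:E)%E.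
Proof.
move=> v1 e0.
have v1' : leb.-integrable setT (EFin \o (v \_ I01 : lebType R -> R)).
  rewrite -restrict_EFin; apply/(integrable_mkcond _ measurable_I01).
  exact: v1.
have [d [d0 H]] := integral_normr_continuous v1' e0.
exists d => // A [mA A01] Ad; have := H A mA Ad.
rewrite /Rintegral -lte_fin fineK; last first.
  have := integrable_norm v1' => /(integrableS measurableT mA (@subsetT _ _)).
  exact: integrable_fin_num.
rewrite (@eq_integral _ (lebType R) _ _ _ (fun t => `|v t|%:E))//.
move=> t /[!inE] At.
by rewrite patchE mem_set//; exact: A01.
Qed.

End AbsoluteContinuity.

(** * Partial derivatives of the data of (E) *)

Section ProblemE.
Context {R : realType}.
Implicit Types x u lambda beta z : R -> R.

Lemma problemE_fx x u t : along_x x u (ocf (problemE R)) t = 0.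
Proof. by rewrite /along_x /= derive1_cst. Qed.

Lemma problemE_gx x u : along_x x u (ocg (problemE R)) = fun=> 0.
Proof. by apply/funext => t; rewrite /along_x /= derive1_cst. Qed.

Lemma problemE_Lx x u t : along_x x u (ocL (problemE R)) t = -1.
Proof. by rewrite /along_x /= derive1E derive_val. Qed.

Lemma problemE_fu x u t : along_u x u (ocf (problemE R)) t = 1.
Proof. by rewrite /along_u /= derive1E derive_val. Qed.

Lemma problemE_gu x u : along_u x u (ocg (problemE R)) = id.
Proof.
apply/funext => t; rewrite /along_u /= derive1E derive_val.
by rewrite ?scaler0 ?add0r ?subr0 [LHS]mulr1.
Qed.

Lemma problemE_Lu x u t : along_u x u (ocL (problemE R)) t = 0.
Proof. by rewrite /along_u /= derive1_cst. Qed.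

Lemma problemE_adjoint_density x u lambda l0 z :
  adjoint_density (problemE R) x u lambda l0 z = fun=> - l0.
Proof.
apply/funext => t; rewrite /adjoint_density problemE_fx problemE_gx problemE_Lx.
by rewrite mul0r mulr0 mulrN1 add0r addr0.
Qed.
End ProblemE.

Section Multipliers.
Context {R : realType}.
Implicit Types x u lambda beta z : R -> R.
Implicit Type zeta : {additive_charge set (lebType R) -> \bar R}.

(* On [a, 2a] the weight z is at least l0 / (4 a), so its integral there stays
   above l0 / 4 as a tends to 0. *)
Lemma L1_hyperbola_eq0 (l0 : R) z : 0 <= l0 -> L1 z ->
  ae01 (fun t => t * z t = l0 * (1 - t)) -> l0 = 0.
Proof.
move=> l0_ge0 z1 zE; apply/eqP; rewrite eq_le l0_ge0 andbT leNgt.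
apply/negP => l0_gt0.
have [|d d0 H] := @L1_absolutely_continuous _ z (l0 / 4) z1.
  by rewrite divr_gt0.
(* The bound d / 2 makes the length a of [a, 2a] smaller than d. The bound 1 / 4 keeps t <= 1/2
   there, so t z t >= l0 / 2, and t <= 2a then gives z t >= l0 / (4a). *)
pose a := Num.min (d / 2) (1 / 4).
have a0 : 0 < a by rewrite lt_min !divr_gt0.
have ad : a < d by rewrite gt_min ltr_pdivrMr// ltr_pMr// ltr1n.
have a4 : a <= 1 / 4 by rewrite ge_min lexx orbT.
have a0' := ltW a0.
clearbody a.
pose A : set (lebType R) := `[a, 2 * a]%classic.
have hA : LebI A.
  split; first by apply: borel_lebesgue_measurable; exact: measurable_itv.
  move=> t; rewrite /A /I01 /= !in_itv/= => /andP[h1 h2]; apply/andP; split.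
    exact: le_trans a0' h1.
  apply: (le_trans h2); lra.
have lA : leb A = a%:E.
  rewrite /A leb_itv/= lte_fin ltr_pMl ?ltr1n// -EFinB; congr EFin; ring.
have := H _ hA; rewrite lA lte_fin => /(_ ad); apply/negP; rewrite -leNgt.
have -> : (l0 / 4)%:E = (\int[leb]_(t in A)
    (l0 / (4 * a))%:E)%E.
  rewrite integral_cst/=; last by case: hA.
  rewrite lA -EFinM; congr EFin; field.
  by rewrite gt_eqF.
have mz : @measurable_fun _ _ (lebType R) R I01 z.
  by apply/measurable_EFinP; exact: measurable_int z1.
case: hA => mA A01.
apply: (ae_ge0_le_integral mA).
- by move=> t _; rewrite lee_fin divr_ge0// ?mulr_ge0 ?ltW.
- exact: measurable_cst.
- by move=> t _; rewrite lee_fin.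
- apply/measurable_EFinP; apply: measurableT_comp => //.
  by apply: measurable_funS mz; first exact: measurable_I01.
- move: zE; rewrite /ae01; apply: filterS => t zt tA; have /zt := A01 _ tA.
  move: tA; rewrite /A/= in_itv/= => /andP[ta t2a] tz.
  rewrite lee_fin (le_trans _ (ler_norm _))// ler_pdivrMr ?mulr_gt0//.
  have z0 : 0 <= z t.
    rewrite -(@pmulr_rge0 _ t) ?(lt_le_trans a0)// tz mulr_ge0//.
    lra.
  have : t * z t <= 2 * a * z t by rewrite ler_wpM2r.
  have : l0 * (1 / 2) <= t * z t by rewrite tz ler_wpM2l//; lra.
  lra.
Qed.

(** By completeness of [leb], a function that is a.e. equal to a measurable one is measurable. *)
Lemma ae01_eq0_measurable z : ae01 (fun t => z t = 0) ->
  @measurable_fun _ _ (lebType R) R I01 z.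
Proof.
move=> z0; apply/measurable_EFinP.
apply: (@ae_measurable_fun _ _ _ _ completed_lebesgue_measure_is_complete
  _ (cst 0%E)); last exact: measurable_cst.
by move: z0; rewrite /ae_eq /ae01; apply: filterS => t zt t01; rewrite /= zt.
Qed.

Lemma L1norm_eq0 z : ae01 (fun t => z t = 0) -> L1norm z = 0%E.
Proof.
move=> z0; rewrite /L1norm (ae_eq_integral (cst 0%E)).
- exact: integral0.
- exact: measurable_I01.
- apply/measurable_EFinP; apply: measurableT_comp => //.
  exact: ae01_eq0_measurable.
- exact: measurable_cst.
- by move: z0; rewrite /ae01; apply: filterS => t zt t01; rewrite zt// normr0.
Qed.

Lemma ae01_eq0_L1 z : ae01 (fun t => z t = 0) -> L1 z.
Proof.
move=> z0; apply/integrableP; split.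
  by apply/measurable_EFinP; exact: ae01_eq0_measurable.
by have := L1norm_eq0 z0; rewrite /L1norm/= => ->; exact: ltry.
Qed.

Lemma zero01_right_continuous (F : R -> R) t : zero01 F -> 0 < t < 1 ->
  F r @[r --> t^'+] --> F t.
Proof.
move=> F0 /andP[t0 t1]; rewrite F0; last by rewrite /I01/= in_itv/= !ltW.
apply: cvg_near_cst; near=> r; apply: F0.
rewrite /I01/= in_itv/=; apply/andP; split.
  by rewrite ltW// (lt_trans t0).
by near: r; exact: nbhs_right_le.
Unshelve. all: by end_near. Qed.

Lemma zero01_BV01 (F : R -> R) : zero01 F -> BV01 F.
Proof.
move=> F0; split; last by move=> t; exact: zero01_right_continuous.
apply: nondecreasing_bounded_variation => s t s01 t01 _.
by rewrite !F0.
Qed.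

Lemma zero01_stieltjes01 (F : R -> R) : zero01 F -> stieltjes01 F czero.
Proof.
move=> F0 t /andP[t0 t1]; rewrite !F0 ?subrr//.
- by rewrite /I01/= in_itv/= lexx ler01.
- by rewrite /I01/= in_itv/= ltW.
Qed.

Lemma charge_integral_cst0 zeta (E : set R) :
  is_charge_integral zeta E (fun=> 0) 0.
Proof.
have sP : (cst 0 : lebType R -> R) \in @sfun _ (lebType R) R.
  apply/andP; rewrite !inE; split => /=; first exact: measurable_cst.
  by apply: (@sub_finite_set _ _ [set 0]) => // _ [_ _ <-].
exists (fun=> sfun_Sub sP); split.
  move=> e e0; apply: nearW => n; apply: ae01W => t _.
  by rewrite patchE; case: ifP => _; rewrite subrr normr0 ltW.
apply: cvg_near_cst; apply: nearW => n.
rewrite /sintegral fsbig1// => r _.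
have [->|r0] := eqVneq r 0; first by rewrite mul0e.
rewrite (_ : _ `&` _ = set0) ?additive_charge0 ?mule0//.
by apply/seteqP; split => // t [/= /esym/eqP]; rewrite (negPf r0).
Qed.

Lemma multiplier_tuple_origin x u lambda beta l0 z zeta :
  multiplier_tuple (problemE R) x u lambda beta l0 z zeta ->
  origin_tuple lambda beta l0 z zeta.
Proof.
case=> l0_ge0 z1 z_ge0 zba zpure lBV bBV nontriv _ _ l1 b1
  [_ [dl [db [dlE dbE dldb]]]] [bt0 bt] stat zstat.
have zge0 : nonneg_charge zeta by case: zpure.
have beta0 : zero01 beta.
  have b0 : beta 0 = 0.
    apply/eqP; rewrite -oppr_eq0; apply/eqP.
    by move: bt0; rewrite problemE_gx; exact: charge_integral0.
  move=> t; rewrite /I01/= in_itv/= => /andP[t0 t1].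
  have [<-//|tn0] := eqVneq 0 t.
  have [->//|tn1] := eqVneq t 1.
  have [|c [cE cl]] := bt t; first by rewrite !lt_neqAle tn0 tn1 t0.
  have c0 : c = cst 0.
    apply/funext => k; move: (cE k); rewrite problemE_gx.
    exact: charge_integral0.
  apply/eqP; rewrite -oppr_eq0; apply/eqP.
  by move: cl; rewrite c0 => /cvg_lim <-//; rewrite lim_cst.
have lambdaE t : I01 t -> lambda t = - l0 * (1 - t).
  (* The adjoint equation is tested on [0, s], where both Stieltjes measures are prescribed and that
     of beta is 0. The case s = 1 and the terminal condition then give the value at 0. *)
  have lE s : 0 < s <= 1 -> lambda s - lambda 0 = l0 * s.
    move=> s01; have /andP[s0 s1] := s01.
    have s0I : `[0, s]%classic `<=` (I01 : set R).
      by move=> r; rewrite /I01/= !in_itv/= => /andP[-> rs]; exact: le_trans s1.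
    have lebs : leb (`[0, s]%classic : set (lebType R)) = s%:E.
      by rewrite leb_itv/= lte_fin s0 -EFinB subr0.
    have := dldb _ (measurable_itv `[0, s]) s0I.
    rewrite dlE// dbE// !beta0 ?subrr ?adde0; last 2 first.
    - by rewrite /I01/= in_itv/= lexx ler01.
    - by rewrite /I01/= in_itv/= s1 ltW.
    rewrite problemE_adjoint_density integral_cst/=; last first.
      by apply: borel_lebesgue_measurable; exact: measurable_itv.
    by rewrite lebs -EFinM => -[]; lra.
  have l0E : lambda 0 = - l0.
    by have := lE 1; rewrite ltr01 lexx l1 => /(_ isT); lra.
  rewrite /I01/= in_itv/= => /andP[t0 t1].
  have [<-|tn0] := eqVneq 0 t; first by rewrite subr0 mulr1.
  by have := lE t; rewrite lt_neqAle tn0 t0 t1 l0E => /(_ isT); lra.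
(* Stationarity reads 0 = lambda t + t z t; the product form avoids dividing at t = 0. *)
have zE : ae01 (fun t => t * z t = l0 * (1 - t)).
  apply: ae01_imply stat => t t01.
  rewrite problemE_fu problemE_gu problemE_Lu lambdaE//; lra.
have l00 : l0 = 0 by exact: L1_hyperbola_eq0 zE.
have z00 : ae01 (fun t => z t = 0).
  apply: ae01_imply2 zE (ae01_neq 0) => t _; rewrite l00 mul0r => /eqP.
  by rewrite mulf_eq0 => /orP[/eqP->/eqP|/eqP].
split => //.
- by move=> t t01; rewrite lambdaE// l00 oppr0 mul0r.
split => //.
- exists I01; first exact: LebI_I01.
  move: nontriv; rewrite l00 add0e L1norm_eq0// add0e.
  by move=> /[swap] ->; rewrite ltxx.
- have := @right_concentrated_tail0 _ zeta zba zge0.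
  rewrite /right_concentrated => H e e0.
  have := H _ e e0; rewrite add0r; apply => a a0.
  apply: charge_integral_id0 => //.
  by have := zstat _ (LebI_itvc1 (ltW a0)); rewrite problemE_gu.
Qed.

(** The derivatives of g are 0 in x and t in u along every process, so among the conditions on zeta
    the process enters only through complementarity, where essential boundedness of u suffices. *)
Lemma origin_multiplier_tuple x u lambda beta l0 z zeta :
  Linfty u -> origin_tuple lambda beta l0 z zeta ->
  multiplier_tuple (problemE R) x u lambda beta l0 z zeta.
Proof.
move=> u_oo [-> z0 lambda0 beta0 [[A hA zA] zpure zba zorig]].
have zge0 : nonneg_charge zeta by case: zpure.
have zc : right_concentrated zeta 0 by move=> e e0; rewrite add0r zorig.
have ztail := cval_tail0 zge0 zc.
have z1 : L1 z by exact: ae01_eq0_L1.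
have I0 : I01 (0 : R) by rewrite /I01/= in_itv/= lexx ler01.
have I1 : I01 (1 : R) by rewrite /I01/= in_itv/= lexx ler01.
split => //.
- by apply: ae01_imply z0 => t _ ->.
- exact: zero01_BV01.
- exact: zero01_BV01.
- rewrite add0e L1norm_eq0// add0e.
  rewrite (cvalE _ measurable_I01) lte_fin.
  have hI := @LebI_I01 R.
  have := le_cval zge0 hA hI (proj2 hA).
  apply: lt_le_trans; rewrite lt_neqAle cval_ge0// andbT eq_sym.
  by apply/eqP => A0; apply: zA; rewrite cvalE ?A0//; case: hA.
- by apply: ae01_imply z0 => t _ ->; rewrite mul0r.
- exact: charge_ae_zero_origin.
- exact: lambda0.
- exact: beta0.
- split.
    rewrite problemE_adjoint_density oppr0.
    exact/ae01_eq0_L1/ae01W.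
  exists czero, czero; split; [exact: zero01_stieltjes01..|].
  move=> B mB B01; rewrite problemE_adjoint_density oppr0.
  by rewrite integral0 /czero oppe0 adde0.
- split.
    by rewrite problemE_gx beta0// oppr0; exact: charge_integral_cst0.
  move=> t /andP[t0 t1]; exists (cst 0); split.
    by move=> k; rewrite problemE_gx; exact: charge_integral_cst0.
  rewrite beta0 ?oppr0; last by rewrite /I01/= in_itv/= !ltW.
  exact: cvg_cst.
- apply: ae01_imply z0 => t t01 ->.
  by rewrite problemE_fu lambda0// !(mulr0, mul0r, addr0).
- by move=> E hE; rewrite problemE_gu; exact: charge_integral_id_origin.
Qed.
End Multipliers.

(** * The minimizer *)

Section IndefiniteIntegrals.
Context {R : realType}.
Implicit Types (v w F G : R -> R) (A B : set (lebType R)).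

Lemma L1_integrable v A :
  L1 v -> LebI A -> leb.-integrable A (fun t => (v t)%:E).
Proof.
move=> v1 [mA A01]; apply: integrableS v1 => //; exact: measurable_I01.
Qed.

Lemma LebI_itvoc (s t : R) : 0 <= s -> t <= 1 ->
  LebI (`]s, t]%classic : set (lebType R)).
Proof.
move=> s0 t1; split.
  by apply: borel_lebesgue_measurable; exact: measurable_itv.
move=> r /=; rewrite /I01/= !in_itv/= => /andP[sr rt].
by rewrite (le_trans s0 (ltW sr)) (le_trans rt).
Qed.

(* The open cut `]s, t] makes the increments additive without null sets. *)
Definition indefinite_integral w F :=
  forall s t : R, 0 <= s -> s <= t -> t <= 1 ->
  F t - F s = (\int[leb]_(r in (`]s, t]%classic : set (lebType R))) w r)%R.

Lemma W11_indefinite_integral v F : L1 v ->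
  (forall t, I01 t ->
     F t = F 0 + (\int[leb]_(s in (`[0%R, t]%classic : set (lebType R)))
       v s)%R) ->
  indefinite_integral v F.
Proof.
move=> v1 FE s t s0 st t1.
have LebIc (r : R) : r <= 1 -> LebI (`[0, r]%classic : set (lebType R)).
  move=> r1; split.
    by apply: borel_lebesgue_measurable; exact: measurable_itv.
  move=> q /=; rewrite /I01/= !in_itv/= => /andP[-> qr].
  by rewrite (le_trans qr).
rewrite FE ?[F s]FE; last 2 first.
- by rewrite /I01/= in_itv/= s0 (le_trans st).
- by rewrite /I01/= in_itv/= t1 (le_trans s0).
have E : (`[0, t] = `[0, s] `|` `]s, t])%classic.
  by rewrite -itv_bndbnd_setU// bnd_simp.
have := @Rintegral_setU _ (lebType R) R leb `[0, s]%classic `]s, t]%classic v.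
rewrite -E => ->.
- by lra.
- by case: (LebIc s (le_trans st t1)).
- by case: (LebI_itvoc s0 t1).
- exact/(L1_integrable v1)/LebIc.
- apply/disj_setPS => r [/=]; rewrite !in_itv/= => /andP[_ rs] /andP[sr _].
  by move: (lt_le_trans sr rs); rewrite ltxx.
Qed.

Lemma is_derive_xbar (t : R) : is_derive t 1 xbar t.
Proof.
have -> : xbar = 2^-1 \*: (id ^+ 2) :> (R -> R).
  by apply/funext => r; rewrite /xbar /= mulrC exprfctE.
apply: is_derive_eq; rewrite /= expr1 /GRing.scale/= mulr1.
by rewrite mulrA mulVf// mul1r.
Qed.

Lemma continuous_xbar : continuous (@xbar R).
Proof.
move=> t; apply/differentiable_continuous/derivable1_diffP.
exact: (@ex_derive _ _ _ _ _ _ _ (is_derive_xbar t)).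
Qed.

Lemma lebesgue_integral_id (t : R) : 0 <= t ->
  (\int[lebesgue_measure]_(r in `[0%R, t]) r%:E = (xbar t)%:E)%E.
Proof.
move=> t0; have xbar0 : xbar 0 = 0 :> R by rewrite /xbar expr0n mul0r.
have [<-|tn0] := eqVneq 0 t.
  by rewrite set_itv1 integral_set1 xbar0.
rewrite (@continuous_FTC2 _ id xbar); first by rewrite xbar0 sube0.
- by rewrite lt_neqAle tn0.
- by apply: continuous_subspaceT => r; exact: cvg_id.
- split.
  + by move=> r _; exact: (@ex_derive _ _ _ _ _ _ _ (is_derive_xbar r)).
  + exact/cvg_at_right_filter/continuous_xbar.
  + exact/cvg_at_left_filter/continuous_xbar.
- move=> r _; rewrite derive1E.
  exact: (@derive_val _ _ _ _ _ _ _ (is_derive_xbar r)).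
Qed.

(** The fundamental theorem of calculus applies to Lebesgue measure on the Borel sets. That measure
    is the pushforward of [leb] under the identity, which carries the value over. *)
Lemma completed_integral_id (t : R) : 0 <= t ->
  (\int[leb]_(r in (`[0%R, t]%classic : set (lebType R))) r%:E = (xbar t)%:E)%E.
Proof.
move=> t0; rewrite -lebesgue_integral_id//.
have mid : measurable_fun setT (idfun : lebType R -> measurableTypeR R).
  by move=> _ Y mY; rewrite setTI; exact: borel_lebesgue_measurable.
transitivity (\int[pushforward leb (idfun : lebType R -> measurableTypeR R)]_(r
    in `[0%R, t]%classic) r%:E)%E; last exact: eq_measure_integral.
rewrite (@ge0_integral_pushforward _ _ (lebType R) (measurableTypeR R)).
- by [].
- exact: mid.
- exact: measurable_itv.
- by apply/measurable_EFinP; exact: measurable_id.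
- by move=> r; rewrite inE/= in_itv/= => /andP[r0 _]; rewrite lee_fin.
Qed.

Lemma measurable_fun_lebesgue_id (D : set R) :
  measurable D -> @measurable_fun _ _ (lebType R) R D id.
Proof. by move=> mD; exact: measurable_fun_lebesgue. Qed.

Lemma leb_I01 : leb (I01 : set (lebType R)) = 1%E.
Proof. by rewrite /I01 leb_itv/= lte_fin ltr01 -EFinB subr0. Qed.

Lemma bounded_L1 v (M : R) : @measurable_fun _ _ (lebType R) R I01 v ->
  (forall t, I01 t -> `|v t| <= M) -> L1 v.
Proof.
move=> mv vM; apply: (@measurable_bounded_integrable _ (lebType R) R leb v I01).
- exact: measurable_I01.
- by have := leb_I01 => /= ->; exact: ltry.
- exact: mv.
- exists M; split; first exact: num_real.
  by move=> N MN t t01; rewrite /= (le_trans (vM t t01))// ltW.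
Qed.

Lemma L1_id : L1 (id : R -> R).
Proof.
apply: (@bounded_L1 _ 1).
  by apply: measurable_fun_lebesgue_id; exact: measurable_itv.
by move=> t; rewrite /I01/= in_itv/= => /andP[t0 t1]; rewrite ger0_norm.
Qed.

Lemma W11_xbar : W11 (@xbar R).
Proof.
exists id; first exact: L1_id.
move=> t; rewrite /I01/= in_itv/= => /andP[t0 _].
rewrite /Rintegral completed_integral_id//= /xbar expr0n/=; lra.
Qed.

Lemma W11_sub F G : W11 F -> W11 G -> W11 (F \- G).
Proof.
move=> [v v1 FE] [w w1 GE]; exists (v \- w).
  exact: (integrableB measurable_I01 v1 w1).
move=> t t01.
have hT : LebI (`[0%R, t]%classic : set (lebType R)).
  split; first by apply: borel_lebesgue_measurable; exact: measurable_itv.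
  move: t01; rewrite /I01/= in_itv/= => /andP[_ t1] r /=.
  by rewrite !in_itv/= => /andP[-> rt]; rewrite (le_trans rt).
rewrite RintegralB; [|by case: hT|exact: L1_integrable|exact: L1_integrable].
by rewrite /= FE// GE//; ring.
Qed.

End IndefiniteIntegrals.

(** * Monotonicity from the sign of an a.e. derivative *)

Section Monotonicity.
Context {R : realType}.

(** Let c be the supremum of the points where G is at most G a. Comparing across c shows that c is
    such a point, and, if c < b, that a later point is one too. Only pairs straddling c are
    compared, as a derivative at c controls no others. *)
Lemma locally_nonincreasing (G : R -> R) (a b : R) : a <= b ->
  (forall c, a <= c <= b -> exists2 r, 0 < r & forall s t,
     a <= s -> s <= c -> c <= t -> t <= b -> t - s < r -> G t <= G s) ->
  G b <= G a.
Proof.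
move=> ab loc; pose S := [set t | a <= t <= b /\ G t <= G a].
have Sa : S a by split; rewrite ?lexx.
have hS : has_sup S by split; [exists a|exists b => t [/andP[]]].
set c := sup S.
have ac : a <= c by apply: sup_upper_bound.
have cb : c <= b by apply: ge_sup; [exists a|move=> t [/andP[]]].
have [|r r0 Gr] := loc c; first by rewrite ac.
have [s [/andP[as_ sb] Gs] cs] := sup_adherent r0 hS.
have sc : s <= c by apply: sup_upper_bound => //; split; rewrite ?as_.
have Gc : G c <= G a.
  by apply: le_trans Gs; apply: Gr => //; rewrite -/c in cs; lra.
move: cb; rewrite le_eqVlt => /predU1P[<-//|cb].
pose t := Num.min b (c + r / 2).
have ct : c < t by rewrite lt_min cb ltrDl divr_gt0.
have tb : t <= b by rewrite ge_min lexx.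
have St : S t.
  split; first by rewrite tb andbT (le_trans ac)// ltW.
  apply: le_trans Gc; apply: Gr => //; first exact: ltW.
  have : t <= c + r / 2 by rewrite ge_min lexx orbT.
  clearbody t; lra.
by have := sup_upper_bound hS St; rewrite -/c leNgt ct.
Qed.

(** The difference quotients on both sides of c are below d + e <= e; the two increments are
    added. *)
Lemma is_derive_le0_near (F : R -> R) (c d e : R) : is_derive c 1 F d ->
  d <= 0 -> 0 < e -> exists2 r, 0 < r & forall s t,
    s <= c -> c <= t -> t - s < r -> F t - F s <= e * (t - s).
Proof.
move=> dF d0 e0.
have dcvg : h^-1 *: (F (h *: 1 + c) - F c) @[h --> 0^'] --> d.
  have <- := @derive_val _ _ _ _ _ _ _ dF.
  exact: (@ex_derive _ _ _ _ _ _ _ dF).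
have [r /= r0 Hr] := (cvgrPdist_lt _ _).1 dcvg e e0.
have near_c q : q != c -> `|q - c| < r -> `|d - (q - c)^-1 * (F q - F c)| < e.
  move=> qc qr; have := Hr (q - c); rewrite /ball_ /= sub0r normrN => /(_ qr).
  by rewrite subr_eq0 => /(_ qc); rewrite /GRing.scale/= mulr1 subrK.
exists r => // s t sc ct tsr.
have Ft : F t - F c <= e * (t - c).
  have [->|tc] := eqVneq t c; first by rewrite !subrr mulr0.
  have ct' : 0 < t - c by rewrite subr_gt0 lt_neqAle eq_sym tc.
  have tcr : `|t - c| < r by rewrite gtr0_norm//; lra.
  have := near_c t tc tcr; rewrite ltr_distlC => /andP[_].
  rewrite mulrC ltr_pdivrMr// => h.
  have := mulr_le0_ge0 d0 (ltW ct'); lra.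
have Fs : F c - F s <= e * (c - s).
  have [->|sc'] := eqVneq s c; first by rewrite !subrr mulr0.
  have cs : 0 < c - s by rewrite subr_gt0 lt_neqAle sc'.
  have scr : `|s - c| < r by rewrite distrC gtr0_norm//; lra.
  have := near_c s sc' scr; rewrite ltr_distlC => /andP[_].
  rewrite -[s - c]opprB -[F s - F c]opprB invrN mulrNN.
  rewrite mulrC ltr_pdivrMr// => h.
  have := mulr_le0_ge0 d0 (ltW cs); lra.
lra.
Qed.

(* Outside a null set N the difference quotients are controlled by the
   derivative; on N the increments of F are absorbed by the integral of |w| over
   a small open neighbourhood U of N. *)
Lemma ae_derive_le0_nonincreasing (w F : R -> R) : L1 w ->
  indefinite_integral w F ->
  ae01 (fun t => exists2 d, d <= 0 & is_derive t 1 F d) ->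
  forall a b, 0 <= a -> a <= b -> b <= 1 -> F b <= F a.
Proof.
move=> w1 FE /ae01_null; set N := [set t | _] => -[mN N0] a b a0 ab b1.
apply/ler_addgt0Pr => e e0.
have e20 : 0 < e / 2 by rewrite divr_gt0.
have [d d0 wd] := L1_absolutely_continuous w1 e20.
have [U [oU NU Ud]] : exists U : set R, [/\ open U, N `<=` U &
    (leb (U : set (lebType R)) < d%:E)%E].
  have d20 : 0 < d / 2 by rewrite divr_gt0.
  have [U [oU NU Ud]] := outer_measure_open_le N d20.
  exists U; split => //; apply: le_lt_trans Ud _.
  rewrite [X in (X + _)%E](_ : _ = 0%E); last exact: N0.
  by rewrite add0e lte_fin ltr_pdivrMr// ltr_pMr// ltr1n.
have mU : @measurable _ (lebType R) U.
  by apply: borel_lebesgue_measurable; exact: open_measurable.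
pose wabs t := `|w t|.
have wabs1 : L1 wabs by exact: integrable_norm w1.
pose I s t : set (lebType R) := `]s, t]%classic `&` U.
have LI s t : 0 <= s -> t <= 1 -> LebI (I s t).
  by move=> s0 t1; have [] := LebIID (LebI_itvoc s0 t1) mU.
pose H t : R := (\int[leb]_(r in I a t) wabs r)%R.
have HD s t : a <= s -> s <= t -> t <= 1 ->
    H t - H s = (\int[leb]_(r in I s t) wabs r)%R.
  move=> as_ st t1; rewrite /H.
  have E : I a t = I a s `|` I s t.
    by rewrite /I -setIUl -itv_bndbnd_setU// bnd_simp.
  have s0 := le_trans a0 as_; have s1 := le_trans st t1.
  rewrite E Rintegral_setU.
  - by rewrite addrAC subrr add0r.
  - by case: (LI a s a0 s1).
  - by case: (LI s t s0 t1).
  - by rewrite -E; exact/(L1_integrable wabs1)/LI.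
  - apply/disj_setPS => r [[/= + _] [/= + _]].
    rewrite !in_itv/= => /andP[_ rs] /andP[sr _].
    by move: (lt_le_trans sr rs); rewrite ltxx.
have H_ge0 s t : 0 <= (\int[leb]_(r in I s t) wabs r)%R.
  by apply: Rintegral_ge0 => r _; exact: normr_ge0.
have Hb : H b <= e / 2.
  have h : LebI (I a b) by exact: LI.
  rewrite -lee_fin /H /Rintegral fineK; last first.
    by apply: integrable_fin_num; [case: h|exact: L1_integrable].
  apply/ltW/wd => //; apply: le_lt_trans Ud; apply: le_measure.
  - by rewrite inE; case: h.
  - by rewrite inE.
  - exact: subIsetr.
have Ha : H a = 0.
  rewrite /H (_ : I a a = set0) ?Rintegral_set0//.
  apply/seteqP; split => // r [/= + _].
  by rewrite in_itv/= => /andP[/lt_le_trans h /h]; rewrite ltxx.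
(* Two allowances make G locally nonincreasing: the slope e / 2 pays at points of differentiability,
   H pays inside U. Each amounts to at most e / 2 over [a, b]. *)
pose G t := F t - e / 2 * t - H t.
have GE s t : F t - F s <= e / 2 * (t - s) + (H t - H s) -> G t <= G s.
  by rewrite /G; clear; lra.
suff : G b <= G a.
  have : e / 2 * (b - a) <= e / 2.
    by rewrite ler_piMr ?(ltW e20)// (le_trans _ b1)// gerBl.
  by move: Hb; rewrite /G Ha; clear; lra.
apply: locally_nonincreasing => // c /andP[ac cb].
(* The case split is on U, not N: near a point of U the whole cut []s, t]] lies in the open set U,
   so H pays for the full increment of F; a point outside U is outside N. *)
have [cU|cU] := pselect (U c).
  have [r /= r0 rU] : exists2 r : R, 0 < r & forall q, `|c - q| < r -> U q.
    have /nbhs_ballP[r /= r0 rU] := open_nbhs_nbhs (conj oU cU).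
    by exists r => // q cq; apply: rU.
  exists r => // s t as_ sc ct tb tsr.
  have st := le_trans sc ct; have t1 := le_trans tb b1.
  have s0 := le_trans a0 as_.
  have := HD s t as_ st t1; have := FE s t s0 st t1.
  have -> : I s t = `]s, t]%classic.
    apply/seteqP; split; first exact: subIsetl.
    move=> q /= hq; split => //; apply: rU.
    move: hq; rewrite /= in_itv/= => /andP[sq qt].
    rewrite ltr_norml ltrNl opprB (le_lt_trans (lerB qt sc) tsr)/=.
    exact: le_lt_trans (lerB ct (ltW sq)) tsr.
  move=> Fst Hst.
  have := le_normr_Rintegral (proj1 (LebI_itvoc s0 t1))
    (L1_integrable w1 (LebI_itvoc s0 t1)).
  rewrite -Fst -[X in _ <= X]/(\int[leb]_(r in
    (`]s, t]%classic : set (lebType R))) wabs r)%R -Hst.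
  move=> /(le_trans (ler_norm _)) FH; apply: GE; apply: le_trans FH _.
  by rewrite lerDr mulr_ge0 ?subr_ge0// ltW.
have c01 : I01 c by rewrite /I01/= in_itv/= (le_trans a0)// (le_trans cb).
have [d' d'0 dF] : exists2 d, d <= 0 & is_derive c 1 F d.
  by apply: contrapT => nF; apply/cU/NU.
have [r r0 Hr] := is_derive_le0_near dF d'0 e20.
exists r => // s t as_ sc ct tb tsr.
apply: GE; apply: (le_trans (Hr s t sc ct tsr)).
by rewrite lerDl HD ?H_ge0 ?(le_trans sc ct) ?(le_trans tb b1).
Qed.

End Monotonicity.

(** * Optimality and uniqueness *)

Section Minimizer.
Context {R : realType}.
Implicit Types x u : R -> R.

Lemma xbar_admissible : admissible (problemE R) xbar ubar.
Proof.
split.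
- exact: W11_xbar.
- split; first by apply: measurable_fun_lebesgue_id; exact: measurable_itv.
  exists 1; apply: ae01W => t /I01P/andP[t0 t1]; rewrite /ubar ger0_norm//.
- by apply: ae01W => t _; exact: is_derive_xbar.
- by apply: ae01W => t _; rewrite /= /ubar expr2 subrr.
- by rewrite /= /xbar expr0n mul0r.
Qed.

Lemma admissible_sub_nonincreasing x u : admissible (problemE R) x u ->
  forall a b, 0 <= a -> a <= b -> b <= 1 ->
    x b - xbar b <= x a - xbar a.
Proof.
move=> [xW _ xu gu _]; have [v v1 FE] := W11_sub xW W11_xbar.
apply: (ae_derive_le0_nonincreasing v1 (W11_indefinite_integral v1 FE)).
have gx : ae01 (fun t => t * u t <= t ^+ 2 /\ is_derive t 1 x (u t)).
  by apply: ae01_imply2 gu xu => t _ /= gt dx; rewrite -subr_le0.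
apply: ae01_imply2 gx (ae01_neq 0) => t /I01P/andP[t0 _] [gt dx] tn0.
exists (u t - t); last exact: is_deriveB dx (is_derive_xbar t).
by rewrite subr_le0 -(@ler_pM2l _ t) -?expr2// lt_neqAle eq_sym tn0.
Qed.

Lemma admissible_le_xbar x u t : admissible (problemE R) x u -> I01 t ->
  x t <= xbar t.
Proof.
move=> ad /I01P/andP[t0 t1].
have := admissible_sub_nonincreasing ad (lexx 0) t0 t1.
case: ad => _ _ _ _ /= ->; rewrite /xbar expr0n mul0r subr0; lra.
Qed.

(** On [0, 1], x is [xbar] plus a monotone function, hence measurable, and it lies between x 1 -
    xbar 1 and 1. The clamp c extends the monotone part to the whole line. *)
Lemma admissible_L1 x u : admissible (problemE R) x u -> L1 x.
Proof.
move=> ad; pose c (t : R) := Num.max 0 (Num.min t 1).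
pose D t := x (c t) - xbar (c t).
have c01 t : 0 <= c t <= 1.
  by rewrite le_max lexx ge_max ler01 ge_min lexx orbT.
have mD : measurable_fun setT D.
  apply: nonincreasing_measurable => // s t st.
  have /andP[cs0 _] := c01 s; have /andP[_ ct1] := c01 t.
  apply: (admissible_sub_nonincreasing ad) => //.
  rewrite /c ge_max le_max lexx/= le_max; apply/orP; right.
  by rewrite le_min !ge_min st lexx orbT.
have mx : @measurable_fun _ _ (lebType R) R I01 x.
  apply: measurable_fun_lebesgue; first exact: measurable_itv.
  apply: (@eq_measurable_fun _ _ _ _ _ (D \+ xbar)).
    move=> t; rewrite inE => /I01P/andP[t0 t1].
    rewrite /D /= /c min_l// max_r// subrK//.
  apply: measurable_funTS; apply: measurable_funD => //.
  by apply: continuous_measurable_fun; exact: continuous_xbar.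
apply: (@bounded_L1 _ _ (`|x 1 - xbar 1| + 1)) => // t /I01P/andP[t0 t1].
have := admissible_sub_nonincreasing ad t0 t1 (lexx 1).
have := @admissible_le_xbar x u t ad; rewrite I01P t0 t1 => /(_ isT).
have := ler_norm (x 1 - xbar 1); have := ler_norm (- (x 1 - xbar 1)).
rewrite normrN.
have : 0 <= xbar t <= 1.
  rewrite /xbar divr_ge0 ?sqr_ge0//= ler_pdivrMr//.
  by rewrite (@le_trans _ _ 1) ?exprn_ile1//; lra.
rewrite ler_norml => /andP[]; lra.
Qed.

Lemma cost_problemE x u : admissible (problemE R) x u ->
  cost (problemE R) x u =
  (- (\int[leb]_(t in (I01 : set (lebType R))) x t)%R)%:E.
Proof.
move=> ad; have x1 := admissible_L1 ad.
rewrite /cost /Rintegral EFinN fineK; last first.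
  by apply: integrable_fin_num; [exact: measurable_I01|exact: x1].
by rewrite -integralN//; exact: integrable_add_def measurable_I01 _ x1.
Qed.

Lemma xbar_global_minimizer : global_minimizer (problemE R) xbar ubar.
Proof.
split; first exact: xbar_admissible.
move=> y v ad; rewrite !cost_problemE//; last exact: xbar_admissible.
rewrite lee_fin lerN2; apply: le_Rintegral.
- exact: measurable_I01.
- exact: admissible_L1 ad.
- exact: admissible_L1 xbar_admissible.
- by move=> t; exact: admissible_le_xbar ad.
Qed.

(** The gap [xbar - x] is nonnegative and nondecreasing. If it is positive at s < 1, it keeps at
    least that size on [s, 1], so its integral is positive and x costs more than [xbar]. *)
Lemma global_minimizer_eq_xbar x u : global_minimizer (problemE R) x u ->
  forall t, I01 t -> x t = xbar t.
Proof.
move=> [ad min].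
have x1 := admissible_L1 ad; have b1 := admissible_L1 xbar_admissible.
have lt1 (s : R) : 0 <= s -> s < 1 -> x s = xbar s.
  move=> s0 s1; apply/eqP; rewrite eq_le (admissible_le_xbar ad); last first.
    by apply/I01P; rewrite s0 ltW.
  rewrite /= leNgt; apply/negP => xs.
  have := min _ _ xbar_admissible.
  rewrite !cost_problemE//; last exact: xbar_admissible.
  rewrite lee_fin lerN2 leNgt => /negP; apply.
  rewrite -subr_gt0 -RintegralB//; last exact: measurable_I01.
  have m1 := LebI_itvc1 s0.
  have E : (I01 = `[0, s[ `|` `[s, 1] :> set R)%classic.
    by rewrite -itv_bndbnd_setU// bnd_simp// ltW.
  pose d : R -> R := xbar \- x.
  have d1 : L1 d by exact: (integrableB measurable_I01 b1 x1).
  have d_ge t : I01 t -> 0 <= d t.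
    by move=> t01; rewrite subr_ge0 (admissible_le_xbar ad).
  have h0 : LebI (`[0, s[%classic : set (lebType R)).
    split; first by apply: borel_lebesgue_measurable; exact: measurable_itv.
    by rewrite E; exact: subsetUl.
  rewrite -[X in 0 < X]/(\int[leb]_(t in (I01 : set (lebType R))) d t)%R E.
  rewrite Rintegral_setU; last 4 first.
  - by case: h0.
  - by case: m1.
  - by rewrite -E.
  - apply/disj_setPS => r [/=]; rewrite !in_itv/= => /andP[_ rs] /andP[sr _].
    by move: (lt_le_trans rs sr); rewrite ltxx.
  apply: ltr_wpDl.
    by apply: Rintegral_ge0 => t t0s; apply: d_ge; case: h0 => _; exact.
  apply: (@lt_le_trans _ _ (d s * (1 - s))).
    by rewrite mulr_gt0// subr_gt0.
  have -> : d s * (1 - s) =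
      (\int[leb]_(t in (`[s, 1]%classic : set (lebType R))) d s)%R.
    rewrite Rintegral_cst; last by case: m1.
    by have := @leb_itv R `[s, 1]; rewrite /= lte_fin s1 => ->.
  apply: le_Rintegral.
  - by case: m1.
  - apply: (@L1_integrable _ (cst (d s))) => //.
    by apply: (@bounded_L1 _ _ `|d s|) => //; exact: measurable_cst.
  - exact: L1_integrable.
  - move=> t /=; rewrite in_itv/= => /andP[st t1].
    rewrite /d/= -lerN2 !opprB.
    exact: admissible_sub_nonincreasing ad s t s0 st t1.
(* At t = 1 no interval is left for that argument. A positive gap at 1 would be the whole increment
   over []s, 1]], the gap being 0 at s, but the integral of |v| bounding this increment is
   arbitrarily small for s near 1. *)
move=> t /I01P/andP[t0]; rewrite le_eqVlt => /predU1P[->|]; last exact: lt1.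
have [xW _ _ _ _] := ad; have [v v1 FE] := W11_sub xW W11_xbar.
apply/eqP; rewrite eq_le (admissible_le_xbar ad); last first.
  by apply/I01P; rewrite ler01 lexx.
rewrite /= leNgt; apply/negP => x1lt.
have e0 : 0 < xbar 1 - x 1 by rewrite subr_gt0.
have [r r0 vr] := L1_absolutely_continuous v1 e0.
pose s := Num.max 0 (1 - r / 2).
have s0 : 0 <= s by rewrite le_max lexx.
have s1 : s < 1 by rewrite gt_max ltr01 gtrBl divr_gt0.
have hs := LebI_itvoc s0 (lexx 1).
have sr : 1 - s < r.
  have : 1 - r / 2 <= s by rewrite le_max lexx orbT.
  clearbody s; clear -r0; lra.
have := vr _ hs; rewrite leb_itv/= lte_fin s1 -EFinB lte_fin => /(_ sr).
apply/negP; rewrite -leNgt.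
have := W11_indefinite_integral v1 FE s0 (ltW s1) (lexx 1).
rewrite /= (lt1 s)// subrr subr0 => F1.
have := le_normr_Rintegral (proj1 hs) (L1_integrable v1 hs).
rewrite -F1 distrC gtr0_norm// -lee_fin /Rintegral fineK//.
apply: integrable_fin_num; first by case: hs.
exact: L1_integrable (integrable_norm v1) hs.
Qed.

(** The functions x and [xbar] need only agree on [0, 1], so their two-sided derivatives are
    compared at interior points, where they agree on a neighbourhood. *)
Lemma global_minimizer_ae_ubar x u : global_minimizer (problemE R) x u ->
  ae01 (fun t => u t = ubar t).
Proof.
move=> xmin; have xE := global_minimizer_eq_xbar xmin.
case: xmin => -[_ _ xu _ _] _.
have := @ae01_interior R _ (fun t (h : 0 < t < 1) => h).
apply: ae01_imply2 xu => t _ xut t01.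
have : is_derive t 1 xbar (u t).
  apply: near_eq_is_derive xut.
  near=> r; apply: xE; apply/I01P.
  have : r \in `]0, 1[ by near: r; exact: near_in_itvoo.
  by rewrite in_itv/= => /andP[/ltW-> /ltW->].
move=> /(@derive_val _ _ _ _ _ _ _) <-.
by have := @derive_val _ _ _ _ _ _ _ (is_derive_xbar t).
Unshelve. all: by end_near. Qed.

End Minimizer.

Theorem proposition3p7 (R : realType) :
  [/\ (global_minimizer (problemE R) xbar ubar /\
       forall x u : R -> R, global_minimizer (problemE R) x u ->
         (forall t, I01 t -> x t = xbar t) /\ ae01 (fun t => u t = ubar t)),
      (forall (lambda beta : R -> R) (lambda0 : R) (z : R -> R)
          (zeta : {additive_charge set (lebType R) -> \bar R}),
        (multiplier_tuple (problemE R) xbar ubar lambda beta lambda0 z zeta <->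
         [/\ degenerate (problemE R) xbar ubar lambda beta lambda0 z zeta,
             zero01 lambda, zero01 beta, right_concentrated zeta 0 &
             exists2 A, LebI A & zeta A <> 0%E]) /\
        (multiplier_tuple (problemE R) xbar ubar lambda beta lambda0 z zeta <->
         origin_tuple lambda beta lambda0 z zeta)),
      (forall x u : R -> R, admissible (problemE R) x u ->
        forall (lambda beta : R -> R) (lambda0 : R) (z : R -> R)
          (zeta : {additive_charge set (lebType R) -> \bar R}),
        origin_tuple lambda beta lambda0 z zeta ->
        multiplier_tuple (problemE R) x u lambda beta lambda0 z zeta) &
      completely_degenerate (problemE R)].
Proof.
have ub_oo : Linfty (@ubar R) by case: (@xbar_admissible R).
have degen x u lambda beta l0 z zeta : origin_tuple lambda beta l0 z zeta ->
    degenerate (problemE R) x u lambda beta l0 z zeta /\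
    right_concentrated zeta 0.
  move=> [-> z0 lambda0 beta0 [nz zpure zba zorig]].
  have zc : right_concentrated zeta 0 by move=> e e0; rewrite add0r zorig.
  have I0 : I01 (0 : R) by rewrite /I01/= in_itv/= lexx ler01.
  (* With the concentration point 0, no t in [I01] precedes it, and the clause on alpha is
     vacuous. *)
  split=> //; split=> //; split=> //; exists 0, 0; split=> //.
  - by move=> t /I01P/andP[t0 _]; rewrite ltNge t0.
  - by move=> t t01 _ _; rewrite lambda0// beta0// oppr0.
  - move=> _; rewrite lambda0// beta0// oppr0 problemE_gx; split=> //.
    exact: charge_integral_cst0.
  - by split=> //; right.
split.
- split=> [|x u xmin]; first exact: xbar_global_minimizer.
  split; first exact: global_minimizer_eq_xbar xmin.
  exact: global_minimizer_ae_ubar xmin.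
- move=> lambda beta lambda0 z zeta.
  have H :
      multiplier_tuple (problemE R) xbar ubar lambda beta lambda0 z zeta <->
      origin_tuple lambda beta lambda0 z zeta.
    split; first exact: multiplier_tuple_origin.
    exact: origin_multiplier_tuple.
  split=> //; rewrite H; split.
    move=> h; have [hd hc] := degen xbar ubar _ _ _ _ _ h.
    by case: h => ? ? ? ? [? ? ? ?]; split.
  move=> [[l00 [z0 [ts [al [_ _ _ _ [zba zpure _]]]]]] l0 b0 zc nz].
  split=> //; split=> // e e0.
  by have := zc e e0; rewrite add0r.
- move=> x u [_ uoo _ _ _] lambda beta l0 z zeta.
  exact: origin_multiplier_tuple.
- move=> x u _ lambda beta l0 z zeta /multiplier_tuple_origin h.
  by have [] := degen x u _ _ _ _ _ h.
Qed.
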